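(* Let $f_i(x)=\phi_i(\mathbf{A}_i^\top x)$ for $i\in[n]$, where $\mathbf{A}_i\in\mathbb{R}^{d\times m}$ and $\phi_i:\mathbb{R}^m\to\mathbb{R}$ is $1/\gamma$-smooth ($\gamma>0$) and convex. Let $S$ be a proper sampling on $[n]$ with $p_i=\mathbb{P}[i\in S]$ and weights $\theta_S^i=1/p_i$. If the parameters $v_1,\dots,v_n$ satisfy the ESO inequality $$\mathbb{E}\left[\left\|\sum_{i\in S}\mathbf{A}_ih_i\right\|^2\right]\le\sum_{i=1}^np_iv_i\|h_i\|^2\qquad\text{for all }h_1,\dots,h_n\in\mathbb{R}^m,$$ then the expected smoothness constants $\mathcal{L}_1$ and $\mathcal{L}_2$ (defined in the context) satisfy $$\mathcal{L}_j\le\frac{1}{n\gamma}\max_{i\in[n]}\left\{\frac{v_i}{p_i}\right\},\qquad j=1,2.$$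
   Context: $[n]=\{1,\dots,n\}$; $e\in\mathbb{R}^n$ is the all-ones vector. A sampling is a random subset $S$ of $[n]$; it is proper if $p_i>0$ for all $i$. $f=\frac1n\sum_{i=1}^nf_i$; $\psi:\mathbb{R}^d\to\mathbb{R}\cup\{+\infty\}$ is proper closed convex; $x^*$ is a fixed global minimizer of $P=f+\psi$ (assumed to exist). $L$-smooth means differentiable with $L$-Lipschitz gradient. $\theta_S$ is the diagonal matrix with entries $\theta_S^i$, $\mathbf{I}_S$ is the diagonal $0/1$ indicator matrix of $S$, and $\mathbf{G}(x)=[\nabla f_1(x),\dots,\nabla f_n(x)]$, so $\frac1n\mathbf{G}(x)\theta_S\mathbf{I}_Se=\frac1n\sum_{i\in S}\theta_S^i\nabla f_i(x)$. $\mathcal{L}_1$ is the smallest constant $\ge0$ such that for all $x\in\mathbb{R}^d$: $\mathbb{E}\left[\|\frac1n(\mathbf{G}(x)-\mathbf{G}(x^* ))\theta_S\mathbf{I}_Se\|^2\right]\le2\mathcal{L}_1(f(x)-f(x^* )-\langle\nabla f(x^* ),x-x^*\rangle)$. $\mathcal{L}_2$ is the smallest constant $\ge0$ such that for all $x,y\in\mathbb{R}^d$: $\mathbb{E}\left[\|\frac1n(\mathbf{G}(x)-\mathbf{G}(y))\theta_S\mathbf{I}_Se-\frac1n(\mathbf{G}(x)-\mathbf{G}(y))e\|^2\right]\le2\mathcal{L}_2(f(x)-f(y)-\langle\nabla f(y),x-y\rangle)$. *)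

(* Defs.v *)
From HB Require Import structures.
From mathcomp Require Import all_boot all_order all_algebra.
From mathcomp Require Import all_classical all_reals all_analysis.

Set Implicit Arguments.
Unset Strict Implicit.
Unset Printing Implicit Defensive.

Import Order.TTheory GRing.Theory Num.Theory.
Import numFieldNormedType.Exports.

Local Open Scope classical_set_scope.
Local Open Scope ring_scope.

Section Euclidean.
Context {R : realType}.

Definition inner d (x y : 'cV[R]_d) : R := \sum_(k < d) x k 0 * y k 0.

(* The norm `|x| of MathComp-Analysis on matrices is the max-norm: it is used
   here only through the topology, never as the norm of a vector. *)
Definition enorm d (x : 'cV[R]_d) : R := Num.sqrt (inner x x).

Definition grad d (f : 'cV[R]_d -> R) (x : 'cV[R]_d) : 'cV[R]_d :=
  \col_(k < d) 'D_(delta_mx k 0) f x.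

Definition smooth d (L : R) (f : 'cV[R]_d -> R) : Prop :=
  (forall x, differentiable f x) /\
  (forall x y, enorm (grad f x - grad f y) <= L * enorm (x - y)).

Definition bregman d (f : 'cV[R]_d -> R) (x y : 'cV[R]_d) : R :=
  f x - f y - inner (grad f y) (x - y).

End Euclidean.

Section ExtendedFunctions.
Context {R : realType}.
Local Open Scope ereal_scope.

Definition proper_fun d (psi : 'cV[R]_d -> \bar R) : Prop :=
  (forall x, psi x != -oo) /\ (exists x, psi x != +oo).

Definition epigraph d (psi : 'cV[R]_d -> \bar R) : set ('cV[R]_d * R) :=
  [set z | psi z.1 <= z.2%:E].

(* MathComp-Analysis has 0 * +oo = 0, so t = 0 and t = 1 give no constraint. *)
Definition econvex d (psi : 'cV[R]_d -> \bar R) : Prop :=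
  forall (t : R) (x y : 'cV[R]_d), (0 <= t <= 1)%R ->
    psi (t *: x + (1 - t) *: y)%R <= t%:E * psi x + (1 - t)%:E * psi y.

Definition proper_closed_convex d (psi : 'cV[R]_d -> \bar R) : Prop :=
  [/\ proper_fun psi, closed (epigraph psi) & econvex psi].

Definition global_minimizer d (g : 'cV[R]_d -> \bar R) (x0 : 'cV[R]_d) : Prop :=
  forall x, g x0 <= g x.

End ExtendedFunctions.

Section Sampling.
Context {d0 : measure_display} {Om : measurableType d0} {R : realType}.
Variables (P : probability Om R) (n : nat).
Implicit Types S : Om -> {set 'I_n}.

(* Random subset of the index set: measurability for the discrete
   sigma-algebra on the finite type {set 'I_n}. *)
Definition sampling S : Prop :=
  forall B : {set 'I_n}, measurable (S @^-1` [set B]).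

Definition incl_prob S (i : 'I_n) : R := fine (P [set w | i \in S w]).

Definition proper_sampling S : Prop :=
  sampling S /\ forall i, 0 < incl_prob S i.

Definition ESO d m (A : 'I_n -> 'M[R]_(d, m)) S (v : 'I_n -> R) : Prop :=
  forall h : 'I_n -> 'cV[R]_m,
    ('E_P[fun w => (enorm (\sum_(i in S w) A i *m h i) ^+ 2)%R]
     <= (\sum_(i < n) incl_prob S i * v i * enorm (h i) ^+ 2)%:E)%E.

End Sampling.

Section ExpectedSmoothness.
Context {d0 : measure_display} {Om : measurableType d0} {R : realType}.
Variables (P : probability Om R) (n d : nat).
Implicit Types (S : Om -> {set 'I_n}) (fs : 'I_n -> 'cV[R]_d -> R).
(* weights theta_S^i, allowed to depend on the realised subset *)
Implicit Types theta : {set 'I_n} -> 'I_n -> R.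

Definition avg_fun fs (x : 'cV[R]_d) : R := n%:R^-1 * \sum_(i < n) fs i x.

Definition Gmx fs (x : 'cV[R]_d) : 'M[R]_(d, n) :=
  \matrix_(k < d, i < n) grad (fs i) x k 0.

Definition theta_mx theta (B : {set 'I_n}) : 'M[R]_n :=
  diag_mx (\row_i theta B i).

Definition indic_mx (B : {set 'I_n}) : 'M[R]_n :=
  diag_mx (\row_i (i \in B)%:R).

Definition ones : 'cV[R]_n := const_mx 1.

Definition ES1_constants S theta fs (xs : 'cV[R]_d) : set R :=
  [set c | 0 <= c /\ forall x : 'cV[R]_d,
    ('E_P[fun w => (enorm (n%:R^-1 *:
        ((Gmx fs x - Gmx fs xs) *m theta_mx theta (S w) *m indic_mx (S w)
         *m ones)) ^+ 2)%R]
     <= (2 * c * bregman (avg_fun fs) x xs)%:E)%E].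

Definition ES2_constants S theta fs : set R :=
  [set c | 0 <= c /\ forall x y : 'cV[R]_d,
    ('E_P[fun w => (enorm (n%:R^-1 *:
        ((Gmx fs x - Gmx fs y) *m theta_mx theta (S w) *m indic_mx (S w)
         *m ones)
        - n%:R^-1 *: ((Gmx fs x - Gmx fs y) *m ones)) ^+ 2)%R]
     <= (2 * c * bregman (avg_fun fs) x y)%:E)%E].

End ExpectedSmoothness.

Definition is_minimum {R : realType} (A : set R) (c : R) : Prop :=
  A c /\ lbound A c.

Definition expected_smoothness1 {d0} {Om : measurableType d0} {R : realType}
    (P : probability Om R) n d (S : Om -> {set 'I_n})
    (theta : {set 'I_n} -> 'I_n -> R) (fs : 'I_n -> 'cV[R]_d -> R)
    (xs : 'cV[R]_d) (L1 : R) : Prop :=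
  is_minimum (ES1_constants P S theta fs xs) L1.

Definition expected_smoothness2 {d0} {Om : measurableType d0} {R : realType}
    (P : probability Om R) n d (S : Om -> {set 'I_n})
    (theta : {set 'I_n} -> 'I_n -> R) (fs : 'I_n -> 'cV[R]_d -> R)
    (L2 : R) : Prop :=
  is_minimum (ES2_constants P S theta fs) L2.

(* Main.v *)
Require Import Defs.
From HB Require Import structures.
From mathcomp Require Import all_boot all_order all_algebra.
From mathcomp Require Import all_classical all_reals all_analysis.
From mathcomp Require Import measurable_realfun ring lra.

Set Implicit Arguments.
Unset Strict Implicit.
Unset Printing Implicit Defensive.

Import Order.TTheory GRing.Theory Num.Theory.
Import numFieldNormedType.Exports.

Local Open Scope classical_set_scope.
Local Open Scope ring_scope.

(** Fix [x], [y] and write [p_i] for the inclusion probabilities. Put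
    [h_i = (grad phi_i (A_i^T x) - grad phi_i (A_i^T y)) / (n p_i)]. As
    [grad f_i x = A_i grad phi_i (A_i^T x)], the stochastic gradient difference
    is [\sum_(i in S) A_i h_i], and the ESO inequality bounds its second moment
    by [\sum_i v_i / (n^2 p_i) |grad phi_i (A_i^T x) - grad phi_i (A_i^T y)|^2].
    Each [phi_i] is convex and [1/gamma]-smooth, hence cocoercive
    ([convex_smooth_cocoercive]): the squared norm is at most [2 / gamma] times
    the Bregman divergence of [phi_i] between [A_i^T x] and [A_i^T y], which is
    that of [f_i] between [x] and [y]. Bounding [v_i / p_i] by its maximum and
    averaging over [i] gives [second_moment_le].

    Taking [y = xs] shows that the bound is a feasible constant for the first
    expected smoothness inequality. For the second, the weights [1 / p_i] make
    the stochastic gradient difference an unbiased estimate of the full one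
    ([full_gradientE]), so that the left-hand side is a variance, which is at
    most the second moment. In both cases the feasible constants are those
    satisfying a family of affine inequalities, so a smallest one exists as soon
    as one exists ([affine_minimum]).

    A sampling takes finitely many values, so every expectation is a finite sum
    weighted by the law of the sampling ([integral_sampling]). *)

(** * The Euclidean inner product *)

Section InnerProduct.
Context {R : realType} {d : nat}.
Implicit Types (x y z : 'cV[R]_d) (a : R).

Lemma innerC x y : inner x y = inner y x.
Proof. by apply: eq_bigr => k _; rewrite mulrC. Qed.

Lemma innerDl x y z : inner (x + y) z = inner x z + inner y z.
Proof.
by rewrite /inner -big_split; apply: eq_bigr => k _; rewrite !mxE mulrDl.
Qed.

Lemma innerZl a x y : inner (a *: x) y = a * inner x y.
Proof.
by rewrite /inner mulr_sumr; apply: eq_bigr => k _; rewrite !mxE mulrA.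
Qed.

Lemma innerNl x y : inner (- x) y = - inner x y.
Proof. by rewrite -scaleN1r innerZl mulN1r. Qed.

Lemma innerBl x y z : inner (x - y) z = inner x z - inner y z.
Proof. by rewrite innerDl innerNl. Qed.

Lemma innerDr x y z : inner x (y + z) = inner x y + inner x z.
Proof. by rewrite innerC innerDl !(innerC _ x). Qed.

Lemma innerZr a x y : inner x (a *: y) = a * inner x y.
Proof. by rewrite innerC innerZl (innerC y). Qed.

Lemma innerNr x y : inner x (- y) = - inner x y.
Proof. by rewrite innerC innerNl (innerC y). Qed.

Lemma inner_suml (I : finType) (F : I -> 'cV[R]_d) y :
  inner (\sum_i F i) y = \sum_i inner (F i) y.
Proof.
rewrite /inner exchange_big; apply: eq_bigr => k _.
by rewrite summxE mulr_suml.
Qed.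

Lemma inner_ge0 x : 0 <= inner x x.
Proof. by apply: sumr_ge0 => k _; rewrite -expr2 sqr_ge0. Qed.

Lemma sqr_enorm x : enorm x ^+ 2 = inner x x.
Proof. by rewrite sqr_sqrtr // inner_ge0. Qed.

Lemma enorm_ge0 x : 0 <= enorm x.
Proof. exact: sqrtr_ge0. Qed.

Lemma enormZ a x : enorm (a *: x) = `|a| * enorm x.
Proof.
by rewrite /enorm innerZl innerZr mulrA -expr2 sqrtrM ?sqr_ge0 // sqrtr_sqr.
Qed.

(** The form of the Cauchy-Schwarz inequality needed for Lipschitz gradients;
    it follows from the nonnegativity of the squared norms of [x - a y] and
    [x + a y]. *)
Lemma inner_le_sqr a x y : 0 < a -> inner x x <= a ^+ 2 * inner y y ->
  `|inner x y| <= a * inner y y.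
Proof.
move=> a0 xy; have := inner_ge0 (x - a *: y); have := inner_ge0 (x + a *: y).
rewrite !(innerDl, innerNl, innerZl, innerDr, innerNr, innerZr) (innerC y x).
move=> h1 h2; rewrite ler_norml; apply/andP; split; rewrite -(ler_pM2l a0); nra.
Qed.

End InnerProduct.

(** * Convex functions with a Lipschitz gradient *)

Section Smooth.
Context {R : realType} {d : nat}.
Implicit Types (f : 'cV[R]_d -> R) (x y h : 'cV[R]_d) (L : R).

Lemma derive_inner f x h : differentiable f x -> 'D_h f x = inner (grad f x) h.
Proof.
move=> df; rewrite deriveE //.
have {1}-> : h = \sum_(k < d) h k 0 *: delta_mx k 0.
  apply/colP => k; rewrite summxE (bigD1 k) //= big1 ?addr0 => [|j jk].
    by rewrite !mxE !eqxx mulr1.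
  by rewrite !mxE eq_sym (negbTE jk) mulr0.
rewrite linear_sum; apply: eq_bigr => k _.
by rewrite linearZ mxE deriveE // mulrC.
Qed.

Lemma is_derive_line f x h (t : R) : differentiable f (x + t *: h) ->
  is_derive t (1 : R) (fun s : R => f (x + s *: h))
    (inner (grad f (x + t *: h)) h).
Proof.
move=> df.
have E : (fun s : R => s^-1 *: (((fun s : R => f (x + s *: h)) \o shift t)
             (s *: (1 : R)) - f (x + t *: h)))
       = (fun s : R => s^-1 *: ((f \o shift (x + t *: h)) (s *: h)
                        - f (x + t *: h))).
  apply/funext => s /=; congr (_ *: (f _ - _)).
  by rewrite [s *: _]mulr1 scalerDl addrCA.
apply: DeriveDef; first by rewrite /derivable E; exact: diff_derivable.
by rewrite -derive_inner // /derive E.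
Qed.

(** The descent lemma, in its two-sided form. *)
Lemma smooth_quadratic L f x h : 0 < L -> smooth L f ->
  `|f (x + h) - f x - inner (grad f x) h| <= L / 2 * inner h h.
Proof.
move=> L0 [df lip]; set a := inner (grad f x) h; set q := L / 2 * inner h h.
have key (s : R) : `|s| = 1 -> s * (f (x + h) - f x - a) <= q.
  move=> s1.
  (* Along the segment, the signed error minus the quadratic bound has a
     nonpositive derivative, since the gradient at [x + c h] differs from that
     at [x] by at most [L c |h|]. *)
  pose g : R -> R :=
    s *: ((fun t : R => f (x + t *: h)) - a *: id) - q *: (id ^+ 2).
  pose dg (t : R) : R :=
    s * (inner (grad f (x + t *: h)) h - a) - q * (2 * t).
  have gdrv t : is_derive t (1 : R) g (dg t).
    have ? := is_derive_line (df (x + t *: h)).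
    apply: is_derive_eq.
    by rewrite /dg /GRing.scale /= !mulr1 expr1.
  have [|c /[!in_itv]/= /andP[c0 c1]] :=
      @MVT R g dg 0 1 ltr01 (fun t _ => gdrv t).
    apply: derivable_within_continuous => t _.
    exact: (@ex_derive _ _ _ _ _ _ _ (gdrv t)).
  have gE t : g t = s * (f (x + t *: h) - a * t) - q * t ^+ 2 by [].
  rewrite subr0 mulr1 !gE !scale1r scale0r addr0.
  have : `|inner (grad f (x + c *: h) - grad f x) h| <= L * c * inner h h.
    apply: inner_le_sqr; first by rewrite mulr_gt0.
    rewrite -!sqr_enorm -exprMn ler_sqr ?nnegrE; last 2 first.
    - exact: enorm_ge0.
    - by rewrite mulr_ge0 ?enorm_ge0 // mulr_ge0 // ltW.
    apply: le_trans (lip _ _) _.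
    by rewrite [_ - x]addrC addKr enormZ gtr0_norm // mulrA.
  rewrite innerBl -/a -[leLHS]mul1r -s1 -normrM => /(le_trans (ler_norm _)).
  rewrite /dg /q => h1 h2; nra.
have k1 := key 1 (normr1 _); have k2 := key (-1) (normrN1 _).
by rewrite ler_norml; apply/andP; split; lra.
Qed.

(** The first-order condition for convexity. The quadratic lower bound on [f] at
    [y + t (x - y)], compared with the chord, gives the inequality up to an
    error proportional to [t]. *)
Lemma convex_smooth_bregman_ge0 L f x y : 0 < L -> smooth L f ->
  convex_function [set: 'cV[R]_d] f -> 0 <= bregman f x y.
Proof.
move=> L0 sf cf; rewrite /bregman; set h := x - y; set a := inner _ _.
have step (t : R) : 0 < t -> t <= 1 ->
    a <= f x - f y + t * (L / 2 * inner h h).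
  move=> t0 t1.
  have := smooth_quadratic y (t *: h) L0 sf.
  rewrite !innerZr innerZl => /ler_normlP[+ _].
  have : f (t *: x + (1 - t) *: y) <= t * f x + (1 - t) * f y.
    exact: (cf (Itv01 (ltW t0) t1) x y (in_setT _) (in_setT _)).
  have -> : t *: x + (1 - t) *: y = y + t *: h.
    by rewrite scalerBr scalerBl scale1r addrCA.
  rewrite -/a => h1 h2; rewrite -(ler_pM2l t0); nra.
rewrite leNgt; apply/negP => neg.
have q0 : 0 <= L / 2 * inner h h.
  by rewrite mulr_ge0 ?inner_ge0 // divr_ge0 // ltW.
move: step q0; set q := L / 2 * _; set D := a - (f x - f y) => step q0.
have D0 : 0 < D by rewrite /D; lra.
have Dq0 : 0 < D + q by lra.
(* This value of the step makes the quadratic error smaller than [D]. *)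
have := step (D / (D + q)).
rewrite divr_gt0 // ler_pdivrMr // mul1r lerDl => /(_ isT q0).
rewrite -lerBlDl -/D mulrAC ler_pdivlMr //; nra.
Qed.

(** Cocoercivity. The function [f - inner (grad f y)] is convex and minimal at
    [y], so a gradient step of length [1 / L] from [x] decreases it by at most
    [bregman f x y]; by the descent lemma, it decreases it by at least
    [1 / (2 L)] times the squared norm of its gradient at [x]. *)
Lemma convex_smooth_cocoercive L f x y : 0 < L -> smooth L f ->
  convex_function [set: 'cV[R]_d] f ->
  enorm (grad f x - grad f y) ^+ 2 <= 2 * L * bregman f x y.
Proof.
move=> L0 sf cf; rewrite sqr_enorm; set u := grad f x - grad f y.
have := convex_smooth_bregman_ge0 (x - L^-1 *: u) y L0 sf cf.
have /ler_normlP[_] := smooth_quadratic x (- (L^-1 *: u)) L0 sf.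
have uu : L^-1 * inner u u =
    L^-1 * inner (grad f x) u - L^-1 * inner (grad f y) u.
  by rewrite -mulrBr -innerBl.
clearbody u.
rewrite /bregman !(innerDr, innerNr, innerNl, innerZr, innerZl).
have cc : L / 2 * (L^-1 * (L^-1 * inner u u)) = L^-1 * inner u u / 2.
  by field; lra.
move=> h1 h2; rewrite -mulrA [2 * _]mulrCA -ler_pdivrMl //; lra.
Qed.

End Smooth.

(** * Gradients of compositions with a linear map *)

(** The gradient is determined by the directional derivatives. *)
Lemma gradP (R : realType) (d : nat) (f : 'cV[R]_d -> R) (x g : 'cV[R]_d) :
  (forall h, is_derive x h f (inner g h)) -> grad f x = g.
Proof.
move=> fg; apply/colP => k; rewrite mxE (@derive_val _ _ _ _ _ _ _ (fg _)).
rewrite /inner (bigD1 k) //= big1 ?addr0 => [|j jk].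
  by rewrite !mxE !eqxx mulr1.
by rewrite !mxE (negbTE jk) mulr0.
Qed.

Section CompLinear.
Context {R : realType} {d m : nat} (A : 'M[R]_(d, m)) (phi : 'cV[R]_m -> R).
Implicit Types x h : 'cV[R]_d.

Lemma inner_mulmx (u : 'cV[R]_m) h : inner (A *m u) h = inner u (A^T *m h).
Proof.
have innerE k (a b : 'cV[R]_k) : inner a b = (a^T *m b) 0 0.
  by rewrite mxE; apply: eq_bigr => i _; rewrite mxE.
by rewrite !innerE trmx_mul mulmxA.
Qed.

Lemma is_derive_comp_mulmx x h : differentiable phi (A^T *m x) ->
  is_derive x h (fun z => phi (A^T *m z))
    (inner (A *m grad phi (A^T *m x)) h).
Proof.
move=> dphi.
have E : (fun s : R => s^-1 *: (((fun z => phi (A^T *m z)) \o shift x) (s *: h)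
             - phi (A^T *m x)))
       = (fun s : R => s^-1 *: ((phi \o shift (A^T *m x)) (s *: (A^T *m h))
             - phi (A^T *m x))).
  by apply/funext => s /=; rewrite mulmxDr scalemxAr.
apply: DeriveDef; first by rewrite /derivable E; exact: diff_derivable.
by rewrite inner_mulmx -derive_inner // /derive E.
Qed.

End CompLinear.

(** * Moments of functions of a sampling *)

Section FiniteSampling.
Context {d0 : measure_display} {Om : measurableType d0} {R : realType}.
Variables (P : probability Om R) (n : nat) (S : Om -> {set 'I_n}).
Hypothesis S_sampling : sampling S.

(** The law of the sampling: the probability, as a real number, of drawing
    exactly the subset [B]. *)
Definition draw_prob (B : {set 'I_n}) : R := fine (P (S @^-1` [set B])).

Lemma draw_probE B : P (S @^-1` [set B]) = (draw_prob B)%:E.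
Proof. by rewrite fineK // fin_num_measure. Qed.

Lemma integral_sampling (g : {set 'I_n} -> R) : (forall B, 0 <= g B) ->
  (\int[P]_w (g (S w))%:E = (\sum_B draw_prob B * g B)%:E)%E.
Proof.
move=> g0.
transitivity (\int[P]_w (\sum_B (g B)%:E * (\1_(S @^-1` [set B]) w)%:E))%E.
  apply: eq_integral => w _; rewrite (bigD1 (S w)) //= indicE mem_set //= mule1.
  rewrite big1 ?adde0 // => B BS; rewrite indicE memNset ?mule0 //=.
  by move=> SB; move/eqP: BS; apply.
rewrite ge0_integral_sum //; last 2 first.
- move=> B; apply: measurable_funeM; apply/measurable_EFinP.
  exact: measurable_indic.
- by move=> B w _; rewrite -EFinM lee_fin mulr_ge0.
rewrite -sumEFin; apply: eq_bigr => B _.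
rewrite ge0_integralZl_EFin //; last first.
- by apply/measurable_EFinP; exact: measurable_indic.
rewrite integral_indic // setIT mulrC EFinM; congr (_ * _)%E; exact: draw_probE.
Qed.

Lemma expectation_sqr_enorm d (X : {set 'I_n} -> 'cV[R]_d) :
  ('E_P[fun w => (enorm (X (S w)) ^+ 2)%R] =
   (\sum_B draw_prob B * enorm (X B) ^+ 2)%:E)%E.
Proof.
rewrite unlock (integral_sampling (g := fun B => enorm (X B) ^+ 2)) // => B.
exact: sqr_ge0.
Qed.

Lemma sum_draw_prob : \sum_B draw_prob B = 1.
Proof.
have := @integral_sampling (fun=> 1) (fun=> ler01).
have -> : (\int[P]_w (1 : R)%:E = 1)%E.
  by rewrite integral_cst // mul1e; exact: probability_setT.
move=> -[->].
by apply: eq_bigr => B _; rewrite mulr1.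
Qed.

Lemma incl_probE i : incl_prob P S i = \sum_B draw_prob B * (i \in B)%:R.
Proof.
have := @integral_sampling (fun B => (i \in B)%:R) (fun=> ler0n _ _).
rewrite /incl_prob => /(congr1 (@fine R)) /= <-.
have mi : measurable [set w | i \in S w].
  have -> : [set w | i \in S w] =
      \bigcup_(B in [set B : {set 'I_n} | i \in B]) (S @^-1` [set B]).
    by apply/seteqP; split=> w /=; [move=> iS; exists (S w) | case=> B iB ->].
  by apply: fin_bigcup_measurable => // B _; exact: S_sampling.
rewrite -[in LHS](setIT [set w | _]) -integral_indic //.
congr fine; apply: eq_integral => w _; rewrite indicE; congr (_%:R%:E).
by rewrite mem_setE.
Qed.

(** The variance of a vector-valued function of the sampling is at most its
    second moment. *)
Lemma variance_le_second_moment d (X : {set 'I_n} -> 'cV[R]_d) (M : 'cV[R]_d) :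
  M = \sum_B draw_prob B *: X B ->
  \sum_B draw_prob B * enorm (X B - M) ^+ 2 <=
  \sum_B draw_prob B * enorm (X B) ^+ 2.
Proof.
move=> ME.
have MM : inner M M = \sum_B draw_prob B * inner (X B) M.
  by rewrite {1}ME inner_suml; apply: eq_bigr => B _; rewrite innerZl.
have -> : \sum_B draw_prob B * enorm (X B - M) ^+ 2 =
    \sum_B draw_prob B * enorm (X B) ^+ 2 - inner M M.
  transitivity (\sum_B (draw_prob B * enorm (X B) ^+ 2
      - 2 * (draw_prob B * inner (X B) M) + draw_prob B * inner M M)).
    apply: eq_bigr => B _; rewrite !sqr_enorm innerBl !innerDr !innerNr.
    by rewrite (innerC M (X B)); ring.
  rewrite !big_split /= -mulr_suml sum_draw_prob sumrN -mulr_sumr -MM; ring.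
by rewrite gerBl inner_ge0.
Qed.

End FiniteSampling.

(** * Smallest feasible constants *)

(** A smallest nonnegative constant exists among those satisfying a family of
    affine inequalities, as soon as one such constant exists. No sign is assumed
    of the slopes [b i]. *)
Lemma affine_minimum (R : realType) (I : Type) (F : I -> \bar R) (b : I -> R)
    (c : R) :
  let C := [set c | 0 <= c /\ forall i, (F i <= (2 * c * b i)%:E)%E] in
  (forall i, F i \is a fin_num) -> C c -> exists2 c0, is_minimum C c0 & c0 <= c.
Proof.
move=> C Ffin Cc.
have Clb : has_lbound C by exists 0 => a [].
have Cinf : has_inf C by split; [exists c|].
have inf0 : 0 <= inf C by apply: lb_le_inf; [exists c | move=> a []].
exists (inf C); last exact: ge_inf.
split; last by move=> a Ca; exact: ge_inf.
split=> // i; rewrite -(fineK (Ffin i)) lee_fin.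
have [b0|b0] := leP (b i) 0.
  (* Here the bound does not increase with the constant; it holds at [c], hence
     at [inf C <= c]. *)
  case: (Cc) => _ /(_ i); rewrite -(fineK (Ffin i)) lee_fin => /le_trans; apply.
  by rewrite ler_wnM2r // ler_pM2l // ge_inf.
rewrite mulrAC -ler_pdivrMl ?mulr_gt0 //.
apply: lb_le_inf; first by exists c.
move=> a [a0 /(_ i)]; rewrite -(fineK (Ffin i)) lee_fin.
by rewrite mulrAC -ler_pdivrMl ?mulr_gt0.
Qed.

(** * Second moment of the stochastic gradient *)

Section Bounds.
Context {d0 : measure_display} {Om : measurableType d0} {R : realType}.
Variables (P : probability Om R) (n d m : nat).
Variables (A : 'I_n -> 'M[R]_(d, m)) (phi : 'I_n -> 'cV[R]_m -> R).
Variables (gamma : R) (fs : 'I_n -> 'cV[R]_d -> R).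
Variables (S : Om -> {set 'I_n}) (v : 'I_n -> R).
Variable theta : {set 'I_n} -> 'I_n -> R.
Hypothesis gamma_gt0 : 0 < gamma.
Hypothesis phi_smooth : forall i, smooth gamma^-1 (phi i).
Hypothesis phi_convex : forall i, convex_function [set: 'cV[R]_m] (phi i).
Hypothesis fsE : forall i x, fs i x = phi i ((A i)^T *m x).
Hypothesis thetaE : forall B i, theta B i = (incl_prob P S i)^-1.
Hypothesis S_proper : proper_sampling P S.
Hypothesis v_ESO : ESO P A S v.

Local Notation dphi i x := (grad (phi i) ((A i)^T *m x)).

Lemma is_derive_fs i x h : is_derive x h (fs i) (inner (A i *m dphi i x) h).
Proof.
have -> : fs i = fun z => phi i ((A i)^T *m z) by apply/funext; exact: fsE.
exact/is_derive_comp_mulmx/(proj1 (phi_smooth i)).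
Qed.

Lemma grad_fs i x : grad (fs i) x = A i *m dphi i x.
Proof. by apply: gradP => h; exact: is_derive_fs. Qed.

Lemma grad_avg_fun x : grad (avg_fun fs) x = n%:R^-1 *: \sum_i A i *m dphi i x.
Proof.
apply: gradP => h.
have -> : avg_fun fs = n%:R^-1 *: \sum_i fs i.
  by apply/funext => z; rewrite /avg_fun /GRing.scale /= fct_sumE.
have fsh i : is_derive x h (fs i) (inner (A i *m dphi i x) h).
  exact: is_derive_fs.
by apply: is_derive_eq; rewrite innerZl inner_suml.
Qed.

Lemma bregman_avg_fun x y : bregman (avg_fun fs) x y =
  n%:R^-1 * \sum_i bregman (phi i) ((A i)^T *m x) ((A i)^T *m y).
Proof.
rewrite /bregman grad_avg_fun innerZl inner_suml /avg_fun -!mulrBr -!sumrB.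
congr (_ * _); apply: eq_bigr => i _.
by rewrite !fsE inner_mulmx mulmxBr.
Qed.

(** The directions to which the ESO inequality is applied: with them the
    sampled sum of the vectors [A i *m eso_dir x y i] is the stochastic gradient
    difference with weights [1 / p_i]. *)
Definition eso_dir x y i : 'cV[R]_m :=
  (n%:R^-1 / incl_prob P S i) *: (dphi i x - dphi i y).

Lemma Gmx_mulmx x y (w : 'cV[R]_n) : (Gmx fs x - Gmx fs y) *m w =
  \sum_i w i 0 *: (A i *m (dphi i x - dphi i y)).
Proof.
apply/colP => k; rewrite mxE summxE; apply: eq_bigr => i _.
by rewrite mulmxBr -!grad_fs !mxE mulrC.
Qed.

Lemma sampled_gradientE x y (B : {set 'I_n}) :
  n%:R^-1 *: ((Gmx fs x - Gmx fs y) *m theta_mx theta B *m indic_mx B *m ones n)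
  = \sum_(i in B) A i *m eso_dir x y i.
Proof.
rewrite -!mulmxA Gmx_mulmx scaler_sumr [RHS]big_mkcond.
apply: eq_bigr => i _.
rewrite /theta_mx /indic_mx !mul_diag_mx !mxE thetaE mulr1.
case: (i \in B); last by rewrite mulr0 scale0r scaler0.
by rewrite mulr1 scalerA -scalemxAr.
Qed.

(** The stochastic gradient difference is unbiased. *)
Lemma full_gradientE x y :
  n%:R^-1 *: ((Gmx fs x - Gmx fs y) *m ones n) =
  \sum_B draw_prob P S B *: \sum_(i in B) A i *m eso_dir x y i.
Proof.
have [sS p_gt0] := S_proper.
rewrite Gmx_mulmx scaler_sumr.
under [RHS]eq_bigr do rewrite big_mkcond scaler_sumr.
rewrite exchange_big; apply: eq_bigr => i _; rewrite mxE scale1r.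
transitivity (incl_prob P S i *: (A i *m eso_dir x y i)).
  by rewrite -scalemxAr scalerA mulrCA divff ?mulr1 // gt_eqF.
rewrite incl_probE // scaler_suml; apply: eq_bigr => B _.
by case: (i \in B); rewrite ?mulr1 ?mulr0 ?scale0r ?scaler0.
Qed.

(** The ESO inequality, applied to a family whose only nonzero member is a unit
    vector in position [i], forces [v i] to be nonnegative. *)
Lemma ESO_param_ge0 i : (0 < m)%N -> 0 <= v i.
Proof.
move=> m0; have [_ p_gt0] := S_proper.
have := v_ESO (fun j => (j == i)%:R *: delta_mx (Ordinal m0) 0).
have fE (F : 'I_n -> R) :
    (forall j, j != i -> F j = 0) -> \sum_j F j = F i.
  by move=> F0; rewrite (bigD1 i) //= big1 ?addr0.
rewrite fE => [|j /negbTE ->]; last first.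
  by rewrite scale0r sqr_enorm -(scale0r 0) innerZl mul0r mulr0.
rewrite eqxx scale1r sqr_enorm /inner (bigD1 (Ordinal m0)) //=.
rewrite big1 => [|k /negbTE kn]; last first.
  by rewrite !mxE kn mul0r.
rewrite !mxE !eqxx mulr1 addr0 mulr1 => /(le_trans _) h.
have : (0 <= (incl_prob P S i * v i)%:E)%E.
  apply: h; rewrite unlock; apply: integral_ge0 => w _.
  by rewrite lee_fin sqr_ge0.
by rewrite lee_fin pmulr_rge0.
Qed.

(** The ESO inequality followed by cocoercivity of each [phi i]. *)
Lemma second_moment_le (K : R) x y : 0 <= K ->
  (forall i, v i / incl_prob P S i <= K) ->
  \sum_B draw_prob P S B * enorm (\sum_(i in B) A i *m eso_dir x y i) ^+ 2
  <= 2 * ((n%:R * gamma)^-1 * K) * bregman (avg_fun fs) x y.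
Proof.
move=> K0 vK; have [sS p_gt0] := S_proper.
have := v_ESO (eso_dir x y).
rewrite (expectation_sqr_enorm P sS
  (fun B => \sum_(i in B) A i *m eso_dir x y i)).
rewrite lee_fin => /le_trans; apply.
rewrite bregman_avg_fun !mulr_sumr; apply: ler_sum => i _.
rewrite sqr_enorm innerZl innerZr -sqr_enorm.
set b := bregman _ _ _; set p := incl_prob P S i.
have e0 := sqr_ge0 (enorm (dphi i x - dphi i y)).
have coc : enorm (dphi i x - dphi i y) ^+ 2 <= 2 * gamma^-1 * b.
  by apply: convex_smooth_cocoercive; rewrite ?invr_gt0.
have p0 : p != 0 by rewrite /p gt_eqF ?p_gt0.
move: (enorm _ ^+ 2) e0 coc => e e0 coc.
have -> : p * v i * (n%:R^-1 / p * (n%:R^-1 / p * e)) =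
    v i / p * (n%:R^-1 ^+ 2 * e).
  by set N := n%:R^-1; field.
have -> : 2 * ((n%:R * gamma)^-1 * K) * (n%:R^-1 * b) =
    K * (n%:R^-1 ^+ 2 * (2 * gamma^-1 * b)).
  by rewrite invfM; ring.
apply: le_trans (_ : K * (n%:R^-1 ^+ 2 * e) <= _).
  by rewrite ler_wpM2r ?vK // mulr_ge0 ?sqr_ge0.
by rewrite !ler_wpM2l ?sqr_ge0.
Qed.

End Bounds.

Theorem lemmaF5 (R : realType) (d0 : measure_display) (Om : measurableType d0)
    (P : probability Om R) (n d m : nat) (m_gt0 : (0 < m)%N)
    (A : 'I_n.+1 -> 'M[R]_(d, m)) (phi : 'I_n.+1 -> 'cV[R]_m -> R)
    (gamma : R) (gamma_gt0 : 0 < gamma)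
    (phi_smooth : forall i, smooth gamma^-1 (phi i))
    (phi_convex : forall i, convex_function [set: 'cV[R]_m] (phi i))
    (fs : 'I_n.+1 -> 'cV[R]_d -> R)
    (fsE : forall i x, fs i x = phi i ((A i)^T *m x))
    (psi : 'cV[R]_d -> \bar R) (psi_pcc : proper_closed_convex psi)
    (xs : 'cV[R]_d)
    (xs_min : global_minimizer (fun x => (avg_fun fs x)%:E + psi x)%E xs)
    (S : Om -> {set 'I_n.+1}) (S_proper : proper_sampling P S)
    (theta : {set 'I_n.+1} -> 'I_n.+1 -> R)
    (thetaE : forall B i, theta B i = (incl_prob P S i)^-1)
    (v : 'I_n.+1 -> R) (v_ESO : ESO P A S v) :
  let bound := (n.+1%:R * gamma)^-1 *
    \big[Num.max/v ord0 / incl_prob P S ord0]_(i < n.+1)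
       (v i / incl_prob P S i) in
  (exists2 L1, expected_smoothness1 P S theta fs xs L1 & L1 <= bound) /\
  (exists2 L2, expected_smoothness2 P S theta fs L2 & L2 <= bound).
Proof.
set K := \big[_/_]_(i < _) _ => bound.
have [sS p_gt0] := S_proper.
have vK i : v i / incl_prob P S i <= K by exact: le_bigmax.
have K0 : 0 <= K.
  apply: le_trans (vK ord0); apply: divr_ge0; last exact: ltW (p_gt0 _).
  exact: (ESO_param_ge0 S_proper v_ESO).
have bound0 : 0 <= bound by rewrite mulr_ge0 ?invr_ge0 ?mulr_ge0 // ltW.
have moment x y := second_moment_le gamma_gt0 phi_smooth phi_convex fsE
  S_proper v_ESO x y K0 vK.
have sampled := sampled_gradientE phi_smooth fsE thetaE.
pose X x y B := n.+1%:R^-1 *: ((Gmx fs x - Gmx fs y) *m theta_mx theta B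
  *m indic_mx B *m ones n.+1).
pose X0 x y := n.+1%:R^-1 *: ((Gmx fs x - Gmx fs y) *m ones n.+1).
split.
- have EX x := expectation_sqr_enorm P sS (X x xs).
  apply: (affine_minimum (b := fun x => bregman (avg_fun fs) x xs)) => [x|].
    by rewrite EX.
  split=> // x; rewrite EX lee_fin /X.
  by under eq_bigr do rewrite sampled; exact: moment.
- have EX x y := expectation_sqr_enorm P sS (fun B => X x y B - X0 x y).
  rewrite /expected_smoothness2.
  have -> : ES2_constants P S theta fs =
    [set c | 0 <= c /\ forall z : 'cV[R]_d * 'cV[R]_d,
      ('E_P[fun w => (enorm (X z.1 z.2 (S w) - X0 z.1 z.2) ^+ 2)%R] <=
       (2 * c * bregman (avg_fun fs) z.1 z.2)%:E)%E].
    apply/seteqP; split=> c [c0 H]; (split; first exact: c0).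
      by move=> [x y]; exact: H.
    by move=> x y; exact: (H (x, y)).
  apply: (affine_minimum (b := fun z => bregman (avg_fun fs) z.1 z.2)) => [z|].
    by rewrite EX.
  split=> // -[x y]; rewrite EX lee_fin.
  apply: le_trans (moment x y).
  rewrite /X; under eq_bigr do rewrite sampled.
  apply: variance_le_second_moment => //.
  exact: (full_gradientE phi_smooth fsE S_proper).
Qed.
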